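(* Let $G=(V,E)$ be a finite, simple, undirected, connected, unweighted graph with $m$ edges and diameter $\Delta_G$, let $v\in V$, $\epsilon>0$, $p_f\in(0,1)$, and $\omega\ge\frac{8m^2\Delta_G^2\log(2/p_f)}{\epsilon^2}$. Let $T_1,\dots,T_\omega$ be independent uniformly random spanning trees of $G$ and define $$\tilde\kappa(G)=\frac1\omega\sum_{i=1}^\omega\sum_{u\in V}d_u\sum_{(a,b)\in B(u)}\big(\sigma^u_{T_i}(a,b)-g_{T_i}(a,b)\big).$$ Then with probability at least $1-p_f$, $|\tilde\kappa(G)-\kappa(G)|\le\epsilon$, where $\kappa(G)=\mathrm{Tr}(\mathcal{L}^\dagger)$.
   Context: $d_u$ is the degree of $u$, $\mathcal{L}=I-D^{-1/2}AD^{-1/2}$ the normalized Laplacian, $\mathcal{L}^\dagger$ its Moore–Penrose pseudo-inverse (its trace is Kemeny's constant $\kappa(G)$), and $\log$ the natural logarithm. Fix a breadth-first-search tree of $G$ rooted at $v$; for $u\in V$ let $B(u)$ be its path from $u$ to $v$ as a sequence of directed edges $(a,b)$ oriented towards $v$ (empty if $u=v$). For a spanning tree $T$ rooted at $v$ and $a\ne v$, let $\mathrm{par}_T(a)$ be the neighbor of $a$ on the $T$-path from $a$ to $v$ and $\mathrm{sub}_T(a)$ the set of nodes whose $T$-path to $v$ passes through $a$ (including $a$). Set $\sigma^u_T(a,b)=1$ if $b=\mathrm{par}_T(a)$ and $u\in\mathrm{sub}_T(a)$; $\sigma^u_T(a,b)=-1$ if $a=\mathrm{par}_T(b)$ and $u\in\mathrm{sub}_T(b)$;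 $0$ otherwise. Set $g_T(a,b)=\frac1{2m}\sum_{w\in\mathrm{sub}_T(a)}d_w$ if $b=\mathrm{par}_T(a)$, $g_T(a,b)=-\frac1{2m}\sum_{w\in\mathrm{sub}_T(b)}d_w$ if $a=\mathrm{par}_T(b)$, and $0$ otherwise. *)

(* Defs.v *)
From mathcomp Require Import all_boot all_order all_algebra.
From mathcomp Require Import all_classical all_reals all_analysis.

Set Implicit Arguments.
Unset Strict Implicit.
Unset Printing Implicit Defensive.

Import Order.TTheory GRing.Theory Num.Theory.
Local Open Scope ring_scope.

Section MoorePenrose.
Variable R : realFieldType.

Definition is_moore_penrose m n (A : 'M[R]_(m, n)) (B : 'M[R]_(n, m)) : Prop :=
  [/\ A *m B *m A = A, B *m A *m B = B,
      (A *m B)^T = A *m B & (B *m A)^T = B *m A].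

Definition moore_penrose m n (A : 'M[R]_(m, n)) : 'M[R]_(n, m) :=
  xget 0 [set B | is_moore_penrose A B]%classic.

Lemma gram_unitmx m n (F : 'M[R]_(m, n)) : row_free F -> F *m F^T \in unitmx.
Proof.
move=> freeF; rewrite -row_free_unit -kermx_eq0; apply/rowV0P => x /sub_kermxP xFF.
have xF0 : x *m F = 0.
  have /matrixP/(_ 0 0) : x *m F *m (x *m F)^T = 0.
    by rewrite trmx_mul mulmxA -(mulmxA x) xFF mul0mx.
  rewrite !mxE => /eqP; rewrite psumr_eq0; last first.
    by move=> i _; rewrite !mxE -expr2 sqr_ge0.
  move=> /allP sq0; apply/rowP => j.
  have := sq0 j (mem_index_enum j); rewrite !mxE -expr2 sqrf_eq0.
  by move/eqP.
by apply: (row_free_inj freeF); rewrite mul0mx.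
Qed.

Lemma is_moore_penrose_uniq m n (A : 'M[R]_(m, n)) B C :
  is_moore_penrose A B -> is_moore_penrose A C -> B = C.
Proof.
move=> [ABA BAB symAB symBA] [ACA CAC symAC symCA].
have AB_AC : A *m B = A *m C.
  rewrite -{1}ACA -mulmxA -symAC -symAB -trmx_mul symAC.
  by rewrite mulmxA ABA symAC.
have BA_CA : B *m A = C *m A.
  rewrite -{1}ACA -!mulmxA mulmxA -symBA -symCA -trmx_mul symCA.
  by rewrite -mulmxA (mulmxA A B) ABA symCA.
by rewrite -BAB BA_CA -mulmxA AB_AC mulmxA CAC.
Qed.

Lemma moore_penroseP m n (A : 'M[R]_(m, n)) :
  is_moore_penrose A (moore_penrose A).
Proof.
rewrite /moore_penrose; apply: (xgetPex 0).
have [r [C [F [CF fullC freeF]]]] : exists r (C : 'M[R]_(m, r))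
    (F : 'M[R]_(r, n)), [/\ C *m F = A, row_full C & row_free F].
  exists (\rank A), (col_base A), (row_base A).
  by rewrite mulmx_base col_base_full row_base_free.
have uF : F *m F^T \in unitmx by apply: gram_unitmx; exact: freeF.
have uC : C^T *m C \in unitmx.
  rewrite -{2}(trmxK C); apply: gram_unitmx.
  by rewrite /row_free mxrank_tr; exact: fullC.
set iF := invmx (F *m F^T); set iC := invmx (C^T *m C).
have symF : iF^T = iF by rewrite /iF trmx_inv trmx_mul trmxK.
have symC : iC^T = iC by rewrite /iC trmx_inv trmx_mul trmxK.
exists (F^T *m iF *m (iC *m C^T)).
have FB : F *m (F^T *m iF *m (iC *m C^T)) = iC *m C^T.
  by rewrite !mulmxA mulmxV // mul1mx.
have BC : (F^T *m iF *m (iC *m C^T)) *m C = F^T *m iF.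
  by rewrite -!mulmxA mulVmx // mulmx1.
have AB : A *m (F^T *m iF *m (iC *m C^T)) = C *m iC *m C^T.
  by rewrite -CF -mulmxA FB mulmxA.
have BA : (F^T *m iF *m (iC *m C^T)) *m A = F^T *m iF *m F.
  by rewrite -CF mulmxA BC.
split.
- by rewrite AB -CF -!mulmxA (mulmxA C^T) (mulmxA iC) mulVmx // mul1mx.
- by rewrite BA -!mulmxA (mulmxA F) (mulmxA (F *m F^T)) mulmxV // mul1mx.
- by rewrite AB !trmx_mul trmxK symC mulmxA.
- by rewrite BA !trmx_mul trmxK symF mulmxA.
Qed.

End MoorePenrose.

Section Graphs.
Variables (V : finType) (adj : rel V).

Definition degree (u : V) : nat := #|[set w | adj u w]|.

Definition edges : {set {set V}} :=
  [set [set p.1; p.2] | p in [set p : V * V | adj p.1 p.2]].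

(* Length of a shortest walk; equals #|V| if there is no walk. *)
Definition dist (u w : V) : nat :=
  \big[minn/#|V|]_(k < #|V| |
    [exists p : k.-tuple V, path adj u p && (last u p == w)]) k.

Definition diameter : nat := \max_(u : V) \max_(w : V) dist u w.

Definition edge_rel (T : {set {set V}}) : rel V := [rel a b | [set a; b] \in T].

Definition spanning_tree (T : {set {set V}}) : Prop :=
  [/\ T \subset edges,
      forall x y, connect (edge_rel T) x y &
      forall c, ucycle (edge_rel T) c -> (size c < 3)%N].

Definition stree : Type := {T : {set {set V}} | `[< spanning_tree T >]}.

(* States reachable by breadth-first search from v: dequeued vertices in order,
   FIFO queue, and edges used to discover vertices. A step dequeues a and
   enqueues its undiscovered neighbours in an arbitrary order. *)
Inductive bfs (v : V) : seq V -> seq V -> {set {set V}} -> Prop :=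
| bfs_init : bfs v [::] [:: v] finset.set0
| bfs_step done a q T new :
    bfs v done (a :: q) T ->
    perm_eq new [seq b <- enum V | adj a b && (b \notin done ++ a :: q)] ->
    bfs v (rcons done a) (q ++ new) (T :|: [set [set a; b] | b in new]).

Definition bfs_tree (v : V) (T : {set {set V}}) : Prop :=
  exists done, bfs v done [::] T.

Section Rooted.
Variables (v : V) (T : stree).

(* Vertices following u on the simple path from u to v in T. *)
Definition tpath (u : V) : seq V :=
  xget [::] [set p : seq V |
    [/\ path (edge_rel (val T)) u p, last u p = v & uniq (u :: p)]]%classic.

(* The value at the root v is None. *)
Definition par (a : V) : option V := ohead (tpath a).

Definition sub (a : V) : {set V} := [set w | a \in w :: tpath w].

Definition tpath_edges (u : V) : seq (V * V) := zip (u :: tpath u) (tpath u).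

End Rooted.
End Graphs.

Section Kemeny.
Variables (R : realType) (V : finType) (adj : rel V).

Definition adjacency_mx : 'M[R]_#|V| :=
  \matrix_(i, j) (adj (enum_val i) (enum_val j))%:R.

Definition degree_invsqrt_mx : 'M[R]_#|V| :=
  diag_mx (\row_i (Num.sqrt (degree adj (enum_val i))%:R)^-1).

Definition normalized_laplacian : 'M[R]_#|V| :=
  1%:M - degree_invsqrt_mx *m adjacency_mx *m degree_invsqrt_mx.

Definition kemeny : R := \tr (moore_penrose normalized_laplacian).

Definition sigma (v : V) (T : stree adj) (u a b : V) : R :=
  if (par v T a == Some b) && (u \in sub v T a) then 1
  else if (par v T b == Some a) && (u \in sub v T b) then -1
  else 0.

Definition gflow (v : V) (T : stree adj) (a b : V) : R :=
  let c := (2 * #|edges adj|%:R)^-1 in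
  if par v T a == Some b then c * \sum_(w in sub v T a) (degree adj w)%:R
  else if par v T b == Some a then
    - (c * \sum_(w in sub v T b) (degree adj w)%:R)
  else 0.

(* B is the breadth-first-search tree. *)
Definition kemeny_est (v : V) (B : stree adj) (omega : nat)
    (T : 'I_omega -> stree adj) : R :=
  omega%:R^-1 * \sum_(i < omega) \sum_(u : V) (degree adj u)%:R *
    \sum_(ab <- tpath_edges v B u)
      (sigma v (T i) u ab.1 ab.2 - gflow v (T i) ab.1 ab.2).

End Kemeny.

Section RandomElements.
Variables (R : realType) (d : measure_display) (Omega : measurableType d).
Variables (P : probability Omega R) (S : finType).

Definition uniform_element (X : Omega -> S) : Prop :=
  forall s : S, measurable (X @^-1` [set s])%classic /\
    P (X @^-1` [set s])%classic = (#|S|%:R^-1)%:E.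

Definition mutually_independent (I : finType) (X : I -> Omega -> S) : Prop :=
  forall (J : {set I}) (B : I -> {set S}),
    P (\bigcap_(i in [set` J]) (X i @^-1` [set` B i]))%classic =
    (\prod_(i in J) P (X i @^-1` [set` B i])%classic)%E.

End RandomElements.

(* Main.v *)
Require Import Defs.
From mathcomp Require Import all_boot all_order all_algebra.
From mathcomp Require Import all_classical all_reals all_analysis.
From mathcomp Require Import ring lra.
Import Order.TTheory GRing.Theory Num.Theory.
Import numFieldNormedType.Exports.
Set Implicit Arguments.
Unset Strict Implicit.
Unset Printing Implicit Defensive.
Local Open Scope ring_scope.

(* Deleting the edge [ab] from a spanning tree whose path from [u] to [v]
   traverses it in the direction [a -> b] yields a two-component spanning forest
   separating [u], [a] from [b], [v], and this is a bijection. Hence the sum of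
   [sigma^u_T(a,b)] over all trees is [phi_u(a) - phi_u(b)], where [phi_u(a)]
   counts the two-component forests separating [u] from [v] with [a] on the side
   of [u]; since each [sigma^u_T] is a unit flow from [u] to [v], the [phi_u]
   divided by the number of trees are the columns of a generalized inverse [M]
   of the Laplacian. Summing the differences along the BFS paths telescopes, so
   one tree contributes on average
     [sum_u d_u (M_uu - 1/(2m) sum_w d_w M_uw)],
   which is the trace of [Q D^(1/2) M D^(1/2) Q], the pseudo-inverse of the
   normalized Laplacian, with [Q] the projector orthogonal to [D^(1/2) 1].
   Each term [sigma - g] lies in [[-1, 1]] and BFS paths have length at most the
   diameter, so a single tree contributes at most [2 m diam] in absolute value,
   and Hoeffding's inequality concludes. *)

(** * Bridges and simple paths in graphs given by edge sets *)

Section EdgeSets.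
Import mathcomp.boot.fintype mathcomp.boot.finset.
Variable V : finType.
Implicit Types (a b x y z : V) (p : seq V) (F G : {set {set V}}).

Lemma eq_set2 a b c d :
  ([set a; b] == [set c; d]) =
  ((a == c) && (b == d)) || ((a == d) && (b == c)).
Proof.
apply/eqP/idP => [E|/orP[]/andP[/eqP-> /eqP->]//]; last by rewrite setUC.
have := set21 a b; have := set22 a b; have := set21 c d; have := set22 c d.
rewrite {1 2}E -{1 2}E !inE (eq_sym d a) (eq_sym d b) (eq_sym c a) (eq_sym c b).
by case: (a == c); case: (a == d); case: (b == c); case: (b == d).
Qed.

Lemma edge_relE F a b : edge_rel F a b = ([set a; b] \in F).
Proof. by []. Qed.

Lemma edge_rel_sym F : symmetric (edge_rel F).
Proof. by move=> a b; rewrite !edge_relE setUC. Qed.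

Lemma connect_edge_sym F : connect_sym (edge_rel F).
Proof. exact: sym_connect_sym (@edge_rel_sym F). Qed.

Lemma connect_edgeS F G : F \subset G ->
  subrel (connect (edge_rel F)) (connect (edge_rel G)).
Proof.
move=> FG; apply: connect_sub => a b ab; apply: connect1.
exact: (subsetP FG).
Qed.

Lemma path_edgeS F G x p :
  F \subset G -> path (edge_rel F) x p -> path (edge_rel G) x p.
Proof. by move=> FG; apply: sub_path => a b; apply: (subsetP FG). Qed.

Lemma path_edgeD1 F a b x p : a \notin x :: p ->
  path (edge_rel F) x p -> path (edge_rel (F :\ [set a; b])) x p.
Proof.
elim: p x => //= z p IH x; rewrite inE negb_or => /andP[ax azp] /andP[xz zp].
rewrite IH // andbT edge_relE !inE -edge_relE xz andbT eq_set2 ![_ == a]eq_sym (negbTE ax).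
by move: azp; rewrite inE negb_or => /andP[/negbTE-> _]; rewrite andbF.
Qed.

(** A walk can be shortened so that it crosses the added edge at most once, in one direction or the
    other. *)
Lemma connect_edgeU1 F a b x y :
  connect (edge_rel ([set a; b] |: F)) x y ->
  [|| connect (edge_rel F) x y,
      connect (edge_rel F) x a && connect (edge_rel F) b y |
      connect (edge_rel F) x b && connect (edge_rel F) a y].
Proof.
move=> /connectP[p + ->]; elim: p x => [|z p IH] x /=; first by rewrite connect0.
rewrite edge_relE !inE eq_set2 => /andP[+ /IH]; set w := last z p.
case/orP=> [/orP[]/andP[/eqP-> /eqP->]|xz].
- rewrite !connect0 /= orbC => /orP[/orP[/andP[_ ->]|->]|->] //.
  + by rewrite orbT.
  + by rewrite orbT.
- rewrite !connect0 /= => /or3P[->|->|/andP[_ ->]] //; by rewrite ?orbT.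
have xz' : connect (edge_rel F) x z by apply: connect1.
case/or3P=> [zw|/andP[za bw]|/andP[zb aw]].
- by rewrite (connect_trans xz' zw).
- by rewrite (connect_trans xz' za) bw orbT.
- by rewrite (connect_trans xz' zb) aw !orbT.
Qed.

(* Acyclicity in the form "every edge is a bridge", which is stable under
   deleting edges and under joining two components by an edge. *)
Definition bridged F : Prop :=
  forall a b, edge_rel F a b -> ~~ connect (edge_rel (F :\ [set a; b])) a b.

Lemma bridgedS F G : F \subset G -> bridged G -> bridged F.
Proof.
move=> FG brG a b ab; apply: contra (brG a b (subsetP FG _ ab)).
by apply: connect_edgeS; rewrite setSD.
Qed.

(** An old edge stays a bridge: a detour around it through the new edge would, together with the old
    edge itself, connect [a] to [b] inside [F]. *)
Lemma bridgedU1 F a b : bridged F -> ~~ connect (edge_rel F) a b ->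
  bridged ([set a; b] |: F).
Proof.
move=> brF nab x y; rewrite edge_relE !inE => /orP[/eqP E|xyF].
  have -> : ([set a; b] |: F) :\ [set x; y] = F.
    rewrite E; apply: setU1K; apply: contra nab => abF; exact: connect1.
  move/eqP: E; rewrite eq_set2 => /orP[]/andP[/eqP-> /eqP->] //.
  by rewrite connect_edge_sym.
have xyab : [set x; y] != [set a; b].
  by apply: contraNneq nab => E; apply: connect1; rewrite edge_relE -E.
rewrite setDUl; have -> : [set [set a; b]] :\ [set x; y] = [set [set a; b]].
  apply/setP => e; rewrite !inE andbC; case: eqP => //= ->.
  by rewrite eq_sym.
have nxy := brF _ _ xyF.
have sF : F :\ [set x; y] \subset F by apply: subD1set.
have xy : connect (edge_rel F) x y by apply: connect1.
apply/negP => /connect_edgeU1 /or3P[|/andP[xa bY]|/andP[xb aY]].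
- exact/negP.
- move/negP: nab; apply; rewrite connect_edge_sym.
  apply: connect_trans (connect_edgeS sF bY) _; rewrite connect_edge_sym.
  apply: connect_trans _ xy; rewrite connect_edge_sym; exact: connect_edgeS xa.
- move/negP: nab; apply; apply: connect_trans (connect_edgeS sF aY) _.
  rewrite connect_edge_sym; apply: connect_trans xy.
  rewrite connect_edge_sym; exact: connect_edgeS xb.
Qed.

Lemma acyclic_bridged F : (forall a b, edge_rel F a b -> a != b) ->
  (forall c, ucycle (edge_rel F) c -> (size c < 3)%N) -> bridged F.
Proof.
move=> loopless acyF a b ab; apply/negP => /connectP[p0 Fp0 E].
case/shortenP: Fp0 E => p Fp up _ E.
have /acyF : ucycle (edge_rel F) (a :: p).
  apply/andP; split=> //=; rewrite rcons_path -E; apply/andP; split.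
    by apply: path_edgeS Fp; apply: subD1set.
  by have := ab; rewrite edge_rel_sym.
(* The detour has at most one edge: with none, [ab] is a loop; with one, it is the deleted edge
   itself. *)
case: p Fp up E => [|z [|y p]] //=.
  by move=> _ _ E; have := loopless _ _ ab; rewrite E eqxx.
by move=> + _ E; rewrite -E edge_relE !inE eqxx.
Qed.

(** The rest of a cycle of length at least three is a detour around its first edge. *)
Lemma bridged_acyclic F (c : seq V) :
  bridged F -> ucycle (edge_rel F) c -> (size c < 3)%N.
Proof.
move=> brF /andP[]; case: c => [|x [|y [|z c]]] //= /and3P[xy yz Fz].
rewrite !inE !negb_or -!andbA => /and5P[xNy xNz xNc yNz /and3P[yNc zNc _]].
move: (brF _ _ xy); rewrite connect_edge_sym => /negP[]; apply/connectP.
exists (z :: rcons c x); last by rewrite /= last_rcons.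
rewrite /= setUC path_edgeD1 ?andbT //; last first.
  by rewrite !inE mem_rcons inE !negb_or yNz eq_sym xNy.
rewrite edge_relE !inE -edge_relE yz andbT eq_set2 eqxx /= ![z == _]eq_sym (negbTE xNz) /=.
by rewrite eq_sym (negbTE xNy).
Qed.

(** Where the paths diverge, following [q] to the common end and [p] backwards bypasses the next
    edge of [p], which is a bridge. *)
Lemma bridged_path_uniq F x p q : bridged F ->
  path (edge_rel F) x p -> uniq (x :: p) ->
  path (edge_rel F) x q -> uniq (x :: q) -> last x p = last x q -> p = q.
Proof.
move=> brF; elim: p x q => [|y p IH] x [|z q] //=.
- by move=> _ _ _ /andP[+ _] E; rewrite E mem_last.
- by move=> _ /andP[+ _] _ _ E; rewrite -E mem_last.
move=> /andP[xy yp] /andP[xyp uyp] /andP[xz zq] /andP[xzq uzq] E.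
have [yz|yNz] := eqVneq y z.
  by rewrite yz; congr (_ :: _); apply: (IH z) => //; rewrite -?yz // E yz.
have := brF _ _ xy; case/negP.
apply: (@connect_trans _ _ z).
  apply: connect1; rewrite edge_relE !inE -edge_relE xz andbT eq_set2 eqxx /= eq_sym (negbTE yNz).
  apply/negP => /andP[/eqP xEy _]; move: xyp; by rewrite xEy inE eqxx.
apply: (@connect_trans _ _ (last z q)).
  by apply/connectP; exists q => //; apply: path_edgeD1.
by rewrite connect_edge_sym -E; apply/connectP; exists p => //; apply: path_edgeD1.
Qed.

End EdgeSets.

Lemma mem_zip_consP (A : eqType) (u a b : A) (p : seq A) :
  reflect (exists p1 p2, p = p1 ++ b :: p2 /\ last u p1 = a)
    ((a, b) \in zip (u :: p) p).
Proof.
apply: (iffP idP).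
  elim: p u => [|z p IH] u //=; rewrite inE => /orP[/eqP[-> ->]|/IH].
    by exists [::], p.
  by case=> p1 [p2 [-> E]]; exists (z :: p1), p2.
case=> p1 [p2 [-> <-]]; elim: p1 u => [|z p1 IH] u /=; first by rewrite inE eqxx.
by rewrite inE IH orbT.
Qed.

(** * Spanning trees, two-component forests and unit currents *)

Section SpanningTrees.
Import mathcomp.boot.fintype mathcomp.boot.finset.
Variables (V : finType) (adj : rel V).
Hypotheses (adj_sym : symmetric adj) (adj_irr : irreflexive adj).

Lemma mem_edges a b : ([set a; b] \in edges adj) = adj a b.
Proof.
apply/imsetP/idP => [[[x y]]|ab]; last by exists (a, b); rewrite ?inE.
rewrite inE /= => xy /eqP; rewrite eq_set2.
by case/orP=> /andP[/eqP-> /eqP->]; rewrite // adj_sym.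
Qed.

Lemma spanning_treeP T : spanning_tree adj T <->
  [/\ T \subset edges adj, forall x y, connect (edge_rel T) x y & bridged T].
Proof.
split=> -[sT cT aT]; split=> //; last by move=> c; apply: bridged_acyclic.
apply: acyclic_bridged => // a b /(subsetP sT); rewrite mem_edges.
by apply: contraTneq => ->; rewrite adj_irr.
Qed.

Section Root.
Variable v : V.
Implicit Type T : stree adj.

Lemma stree_spanning T : [/\ val T \subset edges adj,
  forall x y, connect (edge_rel (val T)) x y & bridged (val T)].
Proof. exact/spanning_treeP/asboolP/(valP T). Qed.

Lemma tpathP T u : [/\ path (edge_rel (val T)) u (tpath v T u),
  last u (tpath v T u) = v & uniq (u :: tpath v T u)].
Proof.
pose S : set (seq V) := [set p : seq V |
  [/\ path (edge_rel (val T)) u p, last u p = v & uniq (u :: p)]]%classic.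
suff: S (tpath v T u) by [].
apply: (xgetPex [::]).
have [_ /(_ u v)/connectP[p Fp E] _] := stree_spanning T.
by case/shortenP: Fp E => q Fq uq _ E; exists q.
Qed.

Lemma tpath_uniq T u p : path (edge_rel (val T)) u p -> last u p = v ->
  uniq (u :: p) -> tpath v T u = p.
Proof.
move=> Fp lp up; have [Fq lq uq] := tpathP T u; have [_ _ brT] := stree_spanning T.
by apply: (bridged_path_uniq brT Fq uq Fp up); rewrite lp lq.
Qed.

Lemma tpath_catr T u p1 p2 :
  tpath v T u = p1 ++ p2 -> tpath v T (last u p1) = p2.
Proof.
have [+ + +] := tpathP T u => + + + E; rewrite E cat_path last_cat -cat_cons cat_uniq.
move=> /andP[_ Fp2] l2 /and3P[_ dis u2]; apply: tpath_uniq => //=.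
rewrite u2 andbT; apply: contra dis => in2; apply/hasP.
by exists (last u p1) => //; apply: mem_last.
Qed.

(** Translates parents and subtrees into traversed edges: from [a] on, the path of [u] is the path
    of [a], so it leaves [a] towards its parent. *)
Lemma mem_tpath_edges T u a b :
  ((a, b) \in tpath_edges v T u) = (par v T a == Some b) && (u \in sub v T a).
Proof.
rewrite /par inE; apply/mem_zip_consP/andP => [[p1 [p2 [E <-]]]|].
  rewrite (tpath_catr E) /= eqxx; split=> //.
  by rewrite E -cat_cons mem_cat mem_last.
case=> /eqP + au; have [[|c p2] [p1 [E la]]] : exists p2 p1,
    tpath v T u = p1 ++ p2 /\ last u p1 = a.
  by case/splitPl: au => p1 p2 la; exists p2, p1.
  by rewrite -la (tpath_catr E).
rewrite -la (tpath_catr E) /= => -[cb]; exists p1, p2.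
by rewrite E cb.
Qed.

Lemma uniq_tpath_edges T u : uniq (tpath_edges v T u).
Proof.
rewrite /tpath_edges; have [_ _] := tpathP T u; move: (tpath v T u) => p.
elim: p u => //= z p IH u /andP[uNzp uzp]; rewrite IH // andbT.
apply: contra uNzp => /mem_zip_consP[p1 [p2 [-> lz]]].
by rewrite -lz -cat_cons mem_cat mem_last.
Qed.

Lemma par_asym T a b : par v T a = Some b -> par v T b != Some a.
Proof.
rewrite /par; case E: (tpath v T a) => [//|c p] [cb].
have := @tpath_catr T a [:: c] p E; rewrite /= cb => ->.
have [_ _] := tpathP T a; rewrite E => /= /andP[ap _].
case: p {E} ap => //= d p; apply: contra => /eqP[->].
by rewrite !inE eqxx orbT.
Qed.

Lemma tpath_edges_asym T u a b :
  (a, b) \in tpath_edges v T u -> (b, a) \notin tpath_edges v T u.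
Proof.
by rewrite !mem_tpath_edges => /andP[/eqP/par_asym/negbTE-> _].
Qed.

(** A simple path splits at [ab] into two pieces avoiding that edge. Conversely, simple paths from
    [u] to [a] and from [b] to [v] in the cut tree are disjoint, since [ab] is a bridge, so joining
    them by [ab] gives the tree path. *)
Lemma mem_tpath_edges_cut T u a b : (a, b) \in tpath_edges v T u =
  [&& [set a; b] \in val T,
      connect (edge_rel (val T :\ [set a; b])) u a &
      connect (edge_rel (val T :\ [set a; b])) b v].
Proof.
have [sT cT brT] := stree_spanning T.
apply/mem_zip_consP/and3P => [[p1 [p2 [E la]]]|[abT ua bv]].
  have [+ + +] := tpathP T u; rewrite E cat_path last_cat /= mem_cat cat_uniq.
  rewrite la /= => /and3P[Fp1 ab Fp2] l2 /and5P[up1 u1 dis bp2 u2].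
  have bp1 : b \notin u :: p1.
    apply: contra dis; rewrite inE => /orP[/eqP bu|->//].
    by move: up1; rewrite bu inE eqxx /= orbT.
  split=> //; apply/connectP.
    by exists p1 => //; rewrite setUC; apply: path_edgeD1.
  exists p2 => //; apply: path_edgeD1 => //; rewrite inE negb_or.
  rewrite -la; have := mem_last u p1; rewrite inE => /orP[/eqP ->|lp1].
    move: up1; rewrite inE !negb_or => /andP[_ /andP[-> ->]] //.
  apply/andP; split.
    by apply: contraNneq bp1 => <-; rewrite inE lp1 orbT.
  apply: contra dis => lp2; apply/orP; right; apply/hasP; exists (last u p1) => //.
case/connectP: (ua) => p1' F1' E1; case/shortenP: F1' E1 => p1 F1 u1 _ la.
case/connectP: bv => p2' F2' E2; case/shortenP: F2' E2 => p2 F2 u2 _ lb.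
exists p1, p2; split=> //; apply: tpath_uniq.
- rewrite cat_path -la /= edge_relE abT /=.
  by rewrite !(path_edgeS (subD1set _ _) F1, path_edgeS (subD1set _ _) F2).
- by rewrite last_cat /= -lb.
rewrite -cat_cons cat_uniq; apply/and3P; split=> //; apply/hasPn => x xp2.
apply/negP => xp1; case/negP: (brT _ _ abT).
apply: (@connect_trans _ _ x); last first.
  by rewrite connect_edge_sym; apply: path_connect F2 _ xp2.
apply: (@connect_trans _ _ u); first by rewrite connect_edge_sym.
exact: path_connect F1 _ xp1.
Qed.

(** Spanning forests with exactly two components, one of [u] and one of [v]; there are none when
    [u = v]. *)
Definition two_forest (u : V) (F : {set {set V}}) : Prop :=
  [/\ F \subset edges adj, bridged F,
      forall x, connect (edge_rel F) u x || connect (edge_rel F) x v &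
      ~~ connect (edge_rel F) u v].

Definition two_forests (u : V) : {set {set {set V}}} :=
  [set F | `[< two_forest u F >]].

Lemma two_forest_connectN u F x : F \in two_forests u ->
  connect (edge_rel F) x v = ~~ connect (edge_rel F) u x.
Proof.
rewrite inE => /asboolP[_ _ cF nuv]; apply/idP/idP => [xv|]; last first.
  by have := cF x; case: connect.
by apply: contra nuv => ux; apply: connect_trans ux xv.
Qed.

(* Deleting the edge [ab] identifies the trees whose path from [u] to the root
   traverses it with the forests separating [u], [a] from [b], [v]. *)
Lemma card_tpath_edges u a b : adj a b ->
  #|[set T : stree adj | (a, b) \in tpath_edges v T u]| =
  #|[set F in two_forests u | connect (edge_rel F) u a &
                              ~~ connect (edge_rel F) u b]|.
Proof.
move=> ab; pose cut (T : stree adj) := val T :\ [set a; b].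
rewrite -(@card_in_imset _ _ cut); last first.
  move=> T1 T2; rewrite !inE !mem_tpath_edges_cut.
  move=> /and3P[ab1 _ _] /and3P[ab2 _ _] E.
  by apply: val_inj; rewrite -(setD1K ab1) -(setD1K ab2) -/(cut T1) E.
apply: eq_card => F; rewrite !inE; apply/imsetP/and3P => [[T]|].
  rewrite inE mem_tpath_edges_cut => /and3P[abT ua bv] ->.
  have [sT cT brT] := stree_spanning T; have nab := brT _ _ abT.
  have nub : ~~ connect (edge_rel (cut T)) u b.
    apply: contra nab => ub; apply: connect_trans ub.
    by rewrite connect_edge_sym.
  split=> //; apply/asboolP; split.
  - exact: subset_trans (subD1set _ _) sT.
  - exact: bridgedS (subD1set _ _) brT.
  - move=> x; have := cT u x; rewrite -(setD1K abT) => /connect_edgeU1.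
    case/or3P=> [->//|/andP[_ bx]|/andP[ub _]]; last by rewrite ub in nub.
    by rewrite (connect_trans _ bv) ?orbT // connect_edge_sym.
  - apply: contra nub => uv; apply: connect_trans uv _.
    by rewrite connect_edge_sym.
case=> Fin ua nub; have Fin' : F \in two_forests u by rewrite inE.
have bv : connect (edge_rel F) b v by rewrite (two_forest_connectN _ Fin').
case/asboolP: Fin => sF brF cF nuv.
have nab : ~~ connect (edge_rel F) a b.
  by apply: contra nub; apply: connect_trans ua.
have abF : [set a; b] \notin F by apply: contra nab => abF; apply: connect1.
(* Adding [ab] joins the component of [u], which contains [a], to that of [v], which contains
   [b]. *)
have cG x : connect (edge_rel ([set a; b] |: F)) u x.
  have sU : F \subset [set a; b] |: F by apply: subsetU1.
  have /orP[ux|xv] := cF x; first exact: connect_edgeS ux.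
  apply: connect_trans (connect_edgeS sU ua) _.
  apply: (@connect_trans _ _ b); first by apply: connect1; rewrite edge_relE setU11.
  apply: connect_trans (connect_edgeS sU bv) _.
  by rewrite connect_edge_sym; apply: connect_edgeS xv.
have tG : `[< spanning_tree adj ([set a; b] |: F) >].
  apply/asboolP/spanning_treeP; split.
  - by rewrite subUset sub1set mem_edges ab.
  - move=> x y; apply: connect_trans (cG y).
    by rewrite connect_edge_sym.
  - exact: bridgedU1.
pose G : stree adj := exist (fun E => is_true `[< spanning_tree adj E >]) _ tG.
exists G; last by rewrite /cut /= setU1K.
by rewrite inE mem_tpath_edges_cut /= setU11 setU1K // ua.
Qed.

(** The electric potential at [a] of a unit current from [u] to the grounded node [v], scaled by the
    number of spanning trees. *)
Definition forest_potential (u a : V) : nat :=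
  #|[set F in two_forests u | connect (edge_rel F) u a]|.

Lemma forest_potential_root u : forest_potential u v = 0%N.
Proof.
apply/eqP; rewrite cards_eq0; apply/eqP/setP => F; rewrite !inE.
by apply/negP => /andP[/asboolP[_ _ _ /negbTE->]].
Qed.

Section Currents.
Variable R : realType.

(** The two cases of [sigma] exclude each other because a simple path never uses an edge in both
    directions. *)
Lemma sigmaE T u a b : sigma R v T u a b =
  ((a, b) \in tpath_edges v T u)%:R - ((b, a) \in tpath_edges v T u)%:R.
Proof.
rewrite /sigma -!mem_tpath_edges; case: ifP => [/tpath_edges_asym/negbTE->|_].
  by rewrite subr0.
by case: ifP => _; rewrite !sub0r ?oppr0.
Qed.

(** Reduces [gflow] to a degree-weighted average of the flows [sigma], so that only [sigma] has to
    be summed over trees. *)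
Lemma gflowE T a b : gflow R v T a b = (2 * #|edges adj|%:R)^-1 *
  \sum_w (degree adj w)%:R * sigma R v T w a b.
Proof.
rewrite /gflow /=; set c := _^-1.
case: ifPn => [/eqP pa|pa]; last case: ifPn => [pb|pb].
- congr (_ * _); rewrite big_mkcond /=; apply: eq_bigr => w _.
  rewrite /sigma pa eqxx (negbTE (par_asym pa)) /=.
  by case: ifP; rewrite ?mulr1 ?mulr0.
- rewrite -mulrN -sumrN; congr (_ * _); rewrite big_mkcond /=.
  apply: eq_bigr => w _; rewrite /sigma (negbTE pa) pb /=.
  by case: ifP; rewrite ?mulrN1 ?mulr0.
- rewrite big1 ?mulr0 // => w _.
  by rewrite /sigma (negbTE pa) (negbTE pb) mulr0.
Qed.

Lemma sigma_nadj T u a b : ~~ adj a b -> sigma R v T u a b = 0.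
Proof.
have [sT _ _] := stree_spanning T.
move=> nab; have nT : [set a; b] \notin val T.
  by apply: contra nab => /(subsetP sT); rewrite mem_edges.
rewrite sigmaE !mem_tpath_edges_cut [[set b; a]]setUC (negbTE nT) /=.
by rewrite subr0.
Qed.

Lemma sum_tpath_edges T u (f : V -> R) :
  \sum_(ab <- tpath_edges v T u) (f ab.1 - f ab.2) = f u - f v.
Proof.
rewrite /tpath_edges; have [_ + _] := tpathP T u.
move: (tpath v T u) => p <-; elim: p u => [|z p IH] u.
  by rewrite big_nil subrr.
by rewrite big_cons IH /= addrA subrK.
Qed.

(** Kirchhoff's node law for one tree: the indicator of [a] telescopes along the tree path from [u]
    to [v]. *)
Lemma sum_sigma_out T u a :
  \sum_b sigma R v T u a b = (a == u)%:R - (a == v)%:R.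
Proof.
rewrite -(sum_tpath_edges T u (fun x => (a == x)%:R)).
have memE e : (e \in tpath_edges v T u)%:R =
    \sum_(ab <- tpath_edges v T u) (e == ab)%:R :> R.
  rewrite -(count_uniq_mem _ (uniq_tpath_edges T u)) -sum1_count natr_sum.
  by rewrite big_mkcond /=; apply: eq_bigr => ab _; rewrite eq_sym; case: ifP.
under eq_bigr do rewrite sigmaE !memE -sumrB.
rewrite exchange_big /=; apply: eq_bigr => -[x y] _ /=; rewrite sumrB.
congr (_ - _); [rewrite (bigD1 y)//=|rewrite (bigD1 x)//=].
  rewrite xpair_eqE eqxx andbT big1 ?addr0 // => b by_.
  by rewrite xpair_eqE (negbTE by_) andbF.
rewrite xpair_eqE eqxx /= big1 ?addr0 // => b bx.
by rewrite xpair_eqE (negbTE bx).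
Qed.

(** Forests with both [a] and [b] on the side of [u] count in both potentials and cancel;
    [card_tpath_edges] matches the others with trees, one orientation for each sign. *)
Lemma sum_stree_sigma u a b : adj a b -> \sum_(T : stree adj) sigma R v T u a b =
  (forest_potential u a)%:R - (forest_potential u b)%:R.
Proof.
move=> ab; have cardE x y : adj x y ->
    \sum_(T : stree adj) ((x, y) \in tpath_edges v T u)%:R =
    #|[set F in two_forests u | connect (edge_rel F) u x &
                                ~~ connect (edge_rel F) u y]|%:R :> R.
  move=> xy; rewrite -card_tpath_edges // -sum1_card natr_sum big_mkcond.
  by rewrite [RHS]big_mkcond /=; apply: eq_bigr => T _; rewrite inE; case: ifP.
under eq_bigr do rewrite sigmaE.
rewrite sumrB !cardE // 1?adj_sym //.
pose C x := [set F in two_forests u | connect (edge_rel F) u x].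
have splitC x y : forest_potential u x = (#|C x :&: C y| +
    #|[set F in two_forests u | connect (edge_rel F) u x &
                                ~~ connect (edge_rel F) u y]|)%N.
  rewrite /forest_potential -/(C x) -(cardsID (C y) (C x)).
  congr (_ + _)%N; apply: eq_card => F.
  rewrite !inE; case: `[< _ >] => //=.
  by rewrite andbC.
rewrite (splitC a b) (splitC b a) [C b :&: _]setIC !natrD opprD addrACA subrr.
by rewrite add0r.
Qed.

Lemma forest_potential_laplacian u a :
  \sum_(b | adj a b)
    ((forest_potential u a)%:R - (forest_potential u b)%:R) =
  #|{: stree adj}|%:R * ((a == u)%:R - (a == v)%:R) :> R.
Proof.
under eq_bigr => b ab do rewrite -sum_stree_sigma //.
rewrite exchange_big /= -sum1_card natr_sum mulr_suml; apply: eq_bigr => T _.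
rewrite mul1r -(sum_sigma_out T) big_mkcond /=; apply: eq_bigr => b _.
by case: ifPn => // /sigma_nadj->.
Qed.

End Currents.
End Root.
End SpanningTrees.

(** * Handshake identity, breadth-first search and distances *)

Section Distances.
Import mathcomp.boot.fintype mathcomp.boot.finset.
Local Open Scope nat_scope.
Variables (V : finType) (adj : rel V).
Hypotheses (adj_sym : symmetric adj) (adj_irr : irreflexive adj).
Hypothesis adj_conn : forall x y : V, connect adj x y.

Lemma sum_degree : \sum_u degree adj u = 2 * #|edges adj|.
Proof.
pose D := [set p : V * V | adj p.1 p.2].
have -> : \sum_u degree adj u = \sum_(p in D) 1.
  transitivity (\sum_u \sum_(w | adj u w) 1).
    by apply: eq_bigr => u _; rewrite sum1_card; apply: eq_card => w; rewrite inE.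
  by rewrite pair_big_dep /=; apply: eq_bigl => p; rewrite inE.
rewrite (partition_big_imset (fun p : V * V => [set p.1; p.2])) /=.
rewrite mulnC -sum_nat_const; apply: eq_bigr => e /imsetP[[x y]].
rewrite inE /= => xy ->; rewrite sum1dep_card.
have xNy : x != y by apply: contraTneq xy => ->; rewrite adj_irr.
have -> : [set p | (p \in D) && ([set p.1; p.2] == [set x; y])] =
    [set (x, y); (y, x)].
  apply/setP => -[a b]; rewrite !inE /= eq_set2 !xpair_eqE.
  rewrite andb_idl // => /orP[]/andP[/eqP-> /eqP->] //; by rewrite adj_sym.
by rewrite cards2 xpair_eqE (negbTE xNy).
Qed.

Variable v : V.

(** Invariant of the search. The third clause, with the sorted queue, keeps the queue within two
    consecutive levels; this yields the bound on neighbours in the fourth clause when a vertex is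
    dequeued. *)
Definition bfs_level (dn q : seq V) (T : {set {set V}}) (l : V -> nat) : Prop :=
  [/\ l v = 0 /\ v \in dn ++ q,
      pairwise (fun x y => l x <= l y) q,
      forall x y, x \in dn ++ q -> y \in q -> l x <= (l y).+1,
      forall x y, x \in dn -> adj x y -> (y \in dn ++ q) && (l y <= (l x).+1) &
      forall x, x \in dn ++ q -> exists p,
        [/\ path (edge_rel T) x p, last x p = v & size p = l x]].

Lemma bfs_level_exists dn q T : bfs adj v dn q T -> exists l, bfs_level dn q T l.
Proof.
elim=> {dn q T} [|dn a q T new _ [l [[l0 vS] sq near cl pth]] permnew].
  exists (fun=> 0); split=> //; first by rewrite inE eqxx.
  by move=> x; rewrite inE => /eqP->; exists [::].
set S := dn ++ a :: q in vS near cl pth permnew.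
have memnew y : (y \in new) = adj a y && (y \notin S).
  by rewrite (perm_mem permnew) mem_filter mem_enum andbT.
(* Levels of discovered vertices never change; new ones lie one level below the dequeued vertex. *)
pose l' y := if y \in new then (l a).+1 else l y.
have l'S y : y \in S -> l' y = l y by move=> yS; rewrite /l' memnew yS andbF.
have l'new y : y \in new -> l' y = (l a).+1 by rewrite /l' => ->.
have aS : a \in S by rewrite mem_cat inE eqxx orbT.
have qS y : y \in q -> y \in S by move=> yq; rewrite mem_cat inE yq !orbT.
have memS' y : (y \in rcons dn a ++ (q ++ new)) = (y \in S) || (y \in new).
  by rewrite catA cat_rcons mem_cat.
have aq : a \in a :: q by rewrite inE eqxx.
have qq y : y \in q -> y \in a :: q by rewrite inE orbC => ->.
move: sq => /= /andP[/allP laq sq].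
exists l'; split.
- by rewrite memS' vS l'S.
- rewrite pairwise_cat; apply/and3P; split.
  + apply/allrelP => x y xq ynew; rewrite l'S ?qS // l'new //.
    by apply: near => //; apply: qS.
  + rewrite (@eq_in_pairwise _ (mem q) _ (fun x y => l x <= l y)) //.
      by move=> x y xq yq; rewrite !l'S ?qS.
  + rewrite (@eq_in_pairwise _ (mem new) _ (fun x y => true)) //.
    * by elim: {+}new => //= x s ->; rewrite andbT all_predT.
    * by move=> x y xn yn; rewrite !l'new // leqnn.
- move=> x y; rewrite memS' (mem_cat y) => /orP[xS|xn] /orP[yq|yn].
  + by rewrite (l'S x) // (l'S y) ?qS //; apply: near => //; apply: qq.
  + by rewrite l'S // l'new //; apply: leqW; apply: near.
  + by rewrite l'new // l'S ?qS // ltnS laq.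
  + by rewrite !l'new.
- move=> x y; rewrite mem_rcons inE memS' => xa xy.
  have xS : x \in S.
    by case/orP: xa => [/eqP->//|xd]; rewrite mem_cat xd.
  rewrite (l'S x xS); case/orP: xa => [/eqP xa|xd]; last first.
    by have /andP[yS ly] := cl _ _ xd xy; rewrite l'S // yS.
  rewrite xa in xy *; rewrite memnew xy /=; case: (boolP (y \in S)) => yS /=.
    by rewrite l'S //; apply: near.
  by rewrite l'new // memnew xy.
have sT : T \subset T :|: [set [set a; b] | b in new] by apply: subsetUl.
move=> x; rewrite memS' => /orP[xS|xn].
  have [p [Tp lp sp]] := pth x xS; exists p; rewrite l'S //; split=> //.
  exact: path_edgeS Tp.
have [p [Tp lp sp]] := pth a aS; exists (a :: p); rewrite l'new //= sp lp.
split=> //; rewrite (path_edgeS sT Tp) andbT edge_relE inE; apply/orP; right.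
by apply/imsetP; exists x => //; rewrite setUC.
Qed.

Lemma size_tpath_le (T : stree adj) u p :
  path (edge_rel (val T)) u p -> last u p = v -> size (tpath v T u) <= size p.
Proof.
move=> /shortenP[q Tq uq qp] lq; rewrite (tpath_uniq adj_sym adj_irr Tq lq uq).
by apply: uniq_leq_size => //; case/andP: uq.
Qed.

(** With the queue empty every vertex is dequeued, so levels change by at most one along each edge.
    Hence the level of [u] is at most the length of any walk to [v], and it bounds the tree path
    from above. *)
Lemma size_tpath_bfs (T : stree adj) u :
  bfs_tree adj v (val T) -> size (tpath v T u) <= dist adj u v.
Proof.
case=> dn /bfs_level_exists[l [[l0 vS] _ _ cl pth]].
rewrite cats0 in vS cl pth.
have all_dn x : x \in dn.
  have /connectP[p + ->] := adj_conn v x.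
  elim: p v vS {l0 pth} => //= z p IH y yd /andP[yz zp]; apply: IH zp.
  by case/andP: (cl _ _ yd yz).
have lip x p : path adj x p -> l x <= l (last x p) + size p.
  elim: p x => [|z p IH] x /=; first by rewrite addn0.
  move=> /andP[xz /IH zp]; rewrite addnS; apply: leq_trans (_ : (l z).+1 <= _) => //.
  by rewrite adj_sym in xz; case/andP: (cl _ _ (all_dn z) xz).
have [_ _ uq] := tpathP adj_sym adj_irr v T u.
(* The default value [#|V|] of the minimum is harmless: a simple path has fewer edges than that. *)
rewrite /dist; elim/big_ind: _ => [|x y xl yl|k /existsP[p /andP[up /eqP lp]]].
- by rewrite ltnW //; have := max_card (mem (u :: tpath v T u)); rewrite (card_uniqP uq).
- by rewrite leq_min xl.
have [q [Tq lq sq]] := pth u (all_dn u).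
apply: leq_trans (size_tpath_le Tq lq) _; rewrite sq.
by have := lip _ _ up; rewrite lp l0 size_tuple.
Qed.

Lemma dist_diameter u w : dist adj u w <= diameter adj.
Proof.
apply: leq_trans (leq_bigmax (F := dist adj u) w) _.
exact: (leq_bigmax (F := fun x => \max_y dist adj x y)).
Qed.

End Distances.

(* [Q *m Y *m Q] is the pseudo-inverse of the symmetric matrix [L] as soon as
   [Y] inverts [L] on the range of the orthogonal projector [Q]. *)
Lemma mxtrace_moore_penrose (R : realFieldType) n (L Y Q : 'M[R]_n) :
  L^T = L -> Q^T = Q -> Q *m Q = Q -> L *m Q = L -> L *m Y *m Q = Q ->
  \tr (moore_penrose L) = \tr (Y *m Q).
Proof.
move=> symL symQ QQ LQ LYQ; pose X := Q *m Y *m Q.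
have LX : L *m X = Q by rewrite /X !mulmxA LQ.
have QL : Q *m L = L by apply: trmx_inj; rewrite trmx_mul symL symQ.
have XtL : X^T *m L = Q by rewrite -[L in LHS]symL -trmx_mul LX symQ.
have QX : Q *m X = X by rewrite /X !mulmxA QQ.
have XtQ : X^T *m Q = X^T by rewrite -{1}symQ -trmx_mul QX.
(* [Y] need not be symmetric; [X] is, by [X^T = X^T Q = X^T L X = Q X = X]. *)
have symX : X^T = X by rewrite -[LHS]XtQ -{1}LX mulmxA XtL QX.
have XL : X *m L = Q by rewrite -symX.
have mpX : is_moore_penrose L X.
  by split; rewrite ?LX ?XL // /X !mulmxA QQ.
rewrite (is_moore_penrose_uniq (moore_penroseP L) mpX) /X.
by rewrite -mulmxA mxtrace_mulC -mulmxA QQ.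
Qed.

(** * Kemeny's constant from potentials of unit currents *)

Section KemenyTrace.
Variables (R : realType) (V : finType) (adj : rel V).
Hypotheses (adj_sym : symmetric adj) (adj_irr : irreflexive adj).
Hypothesis degree_gt0 : forall u, (0 < degree adj u)%N.

Lemma sum_enum_val (f : V -> R) : \sum_(i < #|V|) f (enum_val i) = \sum_u f u.
Proof.
rewrite [RHS](reindex (enum_val : 'I_#|V| -> V)) //.
by apply: onW_bij; apply: enum_val_bij.
Qed.

Lemma degreeE u : (degree adj u)%:R = \sum_w (adj u w)%:R :> R.
Proof.
rewrite /degree -sum1_card natr_sum big_mkcond /=.
by apply: eq_bigr => w _; rewrite inE; case: ifP.
Qed.

Let sd u : R := Num.sqrt (degree adj u)%:R.

Let sd_neq0 u : sd u != 0.
Proof. by rewrite gt_eqF // sqrtr_gt0 ltr0n. Qed.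

Let sdsd u : sd u * sd u = (degree adj u)%:R.
Proof. by rewrite -expr2 sqr_sqrtr. Qed.

Lemma normalized_laplacianE i j : normalized_laplacian R adj i j =
  (i == j)%:R - (adj (enum_val i) (enum_val j))%:R /
                (sd (enum_val i) * sd (enum_val j)).
Proof.
rewrite /normalized_laplacian /degree_invsqrt_mx /adjacency_mx.
rewrite mul_diag_mx mul_mx_diag !mxE invfM mulrA; congr (_ - _).
by rewrite [(_)^-1 * _]mulrC.
Qed.

(* Column [w] of [M] is a potential of the unit current from [w] to [v]. *)
Lemma kemenyE (v : V) (M : V -> V -> R) :
  (forall a w, \sum_(b | adj a b) (M a w - M b w) = (a == w)%:R - (a == v)%:R) ->
  kemeny R adj = \sum_u (degree adj u)%:R *
    (M u u - (2 * #|edges adj|%:R)^-1 * \sum_w (degree adj w)%:R * M u w).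
Proof.
move=> LM; pose L := normalized_laplacian R adj; set c := _^-1.
(* [s] lies in the kernel of [L] and has squared norm [2m], so [Q] projects orthogonally to it. *)
pose s : 'cV[R]_#|V| := \col_i sd (enum_val i).
pose z : 'cV[R]_#|V| := \col_i ((enum_val i == v)%:R / sd (enum_val i)).
pose Y : 'M[R]_#|V| := \matrix_(i, j)
  (sd (enum_val i) * M (enum_val i) (enum_val j) * sd (enum_val j)).
pose Q : 'M[R]_#|V| := 1%:M - c *: (s *m s^T).
have ss : c *: (s^T *m s) = 1%:M.
  apply/matrixP => i j; rewrite !ord1 !mxE eqxx /=.
  under eq_bigr do rewrite !mxE sdsd.
  rewrite (sum_enum_val (fun u => (degree adj u)%:R)) -natr_sum sum_degree //.
  rewrite natrM mulVf //  mulf_neq0 ?pnatr_eq0 // -lt0n.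
  have /card_gt0P[w] := degree_gt0 v; rewrite inE => vw.
  by apply/card_gt0P; exists [set v; w]; rewrite mem_edges.
have Ls : L *m s = 0.
  apply/colP => i; rewrite !mxE.
  under eq_bigr do rewrite normalized_laplacianE !mxE mulrBl.
  rewrite sumrB (bigD1 i) //= eqxx mul1r [X in _ + X - _]big1 ?addr0; last first.
    by move=> j ji; rewrite eq_sym (negbTE ji) mul0r.
  under eq_bigr => j _ do rewrite invfM mulrA mulfVK ?sd_neq0 //.
  rewrite -mulr_suml (sum_enum_val (fun u => (adj (enum_val i) u)%:R)) -degreeE.
  by rewrite -sdsd mulfK ?sd_neq0 // subrr.
have symL : L^T = L.
  apply/matrixP => i j; rewrite mxE !normalized_laplacianE eq_sym adj_sym.
  by rewrite [sd (enum_val j) * _]mulrC.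
have sQ : s^T *m Q = 0.
  by rewrite /Q mulmxBr mulmx1 -scalemxAr mulmxA scalemxAl ss mul1mx subrr.
have symQ : Q^T = Q.
  by rewrite /Q linearB /= linearZ /= trmx_mul trmxK trmx1.
have LQ : L *m Q = L.
  by rewrite /Q mulmxBr mulmx1 -scalemxAr mulmxA Ls mul0mx scaler0 subr0.
have QQ : Q *m Q = Q.
  by rewrite {1}/Q mulmxBl mul1mx -scalemxAl -mulmxA sQ mulmx0 scaler0 subr0.
(* The hypothesis says that the Laplacian times [M] is the identity minus [e_v 1^T]. Conjugation by
   [D^(1/2)] turns this defect into [z s^T], which [Q] kills on the right. *)
have LY : L *m Y = 1%:M - z *m s^T.
  apply/matrixP => i j; rewrite !mxE big_ord_recl big_ord0 addr0 !mxE.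
  under eq_bigr do rewrite normalized_laplacianE !mxE mulrBl.
  rewrite sumrB (bigD1 i) //= eqxx mul1r [X in _ + X - _]big1 ?addr0; last first.
    by move=> k ki; rewrite eq_sym (negbTE ki) mul0r.
  set a := enum_val i; set w := enum_val j.
  have lapE : \sum_(b | adj a b) (M a w - M b w) =
      (degree adj a)%:R * M a w - \sum_b (adj a b)%:R * M b w.
    rewrite degreeE mulr_suml -sumrB big_mkcond /=; apply: eq_bigr => b _.
    by case: (adj a b); rewrite ?mul1r ?mul0r ?subr0.
  transitivity ((\sum_(b | adj a b) (M a w - M b w)) / sd a * sd w).
    rewrite lapE -sdsd mulrBl mulrBl; congr (_ - _).
      by field; exact: sd_neq0.
    rewrite -sum_enum_val !mulr_suml; apply: eq_bigr => k _.
    by field; rewrite !sd_neq0.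
  rewrite LM (inj_eq enum_val_inj); have [ij|_] := eqVneq i j.
    by rewrite /w -ij -/a; field; exact: sd_neq0.
  by rewrite !sub0r mulNr mulNr.
have LYQ : L *m Y *m Q = Q.
  by rewrite LY mulmxBl mul1mx -mulmxA sQ mulmx0 subr0.
rewrite /kemeny -/L (mxtrace_moore_penrose symL symQ QQ LQ LYQ).
rewrite /Q mulmxBr mulmx1 linearB /= -scalemxAr linearZ /=.
under [RHS]eq_bigr do rewrite mulrBr.
rewrite sumrB; congr (_ - _).
  rewrite -sum_enum_val; apply: eq_bigr => i _.
  by rewrite !mxE -sdsd mulrAC.
(* By cyclicity the trace of [Y s s^T] is the scalar [s^T Y s]. *)
under [RHS]eq_bigr do rewrite mulrCA.
rewrite -mulr_sumr; congr (_ * _); rewrite mulmxA mxtrace_mulC mulmxA.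
rewrite /mxtrace big_ord_recl big_ord0 addr0 !mxE -sum_enum_val.
under eq_bigr do rewrite !mxE mulr_suml.
rewrite exchange_big /=; apply: eq_bigr => i _.
rewrite -sum_enum_val mulr_sumr; apply: eq_bigr => j _.
by rewrite !mxE -!sdsd; ring.
Qed.

End KemenyTrace.

(** * Hoeffding's inequality as a count of samples from a finite set *)

Section Hoeffding.
Variable R : realType.
Implicit Types (p q x y c mu lam e : R).

Lemma is_derive_MVT (f df : R -> R) (s : R) : 0 <= s ->
  (forall x, is_derive x 1 f (df x)) ->
  exists2 c, 0 <= c & f s - f 0 = df c * s.
Proof.
move=> s0 fdf; have [|c] := @MVT_segment R f df 0 s s0.
  by apply: derivable_within_continuous => x _; apply: ex_derive.
rewrite in_itv /= => /andP[c0 _] E; exists c => //.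
by rewrite E subr0.
Qed.

(* The logarithmic derivative [r] of [p e^s + q e^-s] satisfies [r' = 1 - r^2],
   hence [r s <= r 0 + s]. *)
Lemma two_point_mgf p q (s : R) : 0 <= p -> 0 <= q -> p + q = 1 -> 0 <= s ->
  p * expR s + q * expR (- s) <= expR ((p - q) * s + s ^+ 2 / 2).
Proof.
move=> p0 q0 pq s0.
pose w (x : R) := p * expR x + q * expR (- x).
pose w' (x : R) := p * expR x - q * expR (- x).
have wpos x : 0 < w x.
  have [p_gt0|] := ltP 0 p.
    by apply: ltr_wpDr; rewrite ?mulr_ge0 ?mulr_gt0 ?expR_ge0 ?expR_gt0.
  move=> pn; apply: ltr_wpDl; first by rewrite mulr_ge0 ?expR_ge0.
  by rewrite mulr_gt0 ?expR_gt0 //; lra.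
have dexpN x : is_derive x 1 (fun y : R => expR (- y)) (- expR (- x)).
  have := @is_derive1_comp R expR -%R x _ _ (is_derive_expR (- x))
    (is_deriveNid x (1 : R)).
  by rewrite mulrN1.
have dw x : is_derive x 1 w (w' x).
  have := is_deriveD (is_deriveZ p (is_derive_expR x)) (is_deriveZ q (dexpN x)).
  by rewrite scalerN.
have dw' x : is_derive x 1 w' (w x).
  have := is_deriveB (is_deriveZ p (is_derive_expR x)) (is_deriveZ q (dexpN x)).
  by rewrite scalerN opprK.
pose r x := w' x * (w x)^-1.
have dr x : is_derive x 1 r (1 - r x ^+ 2).
  have := is_deriveM (dw' x) (is_deriveV (lt0r_neq0 (wpos x)) (dw x)).
  congr is_derive; rewrite /r /GRing.scale /=; field; exact: lt0r_neq0.
have w0 : w 0 = 1 by rewrite /w oppr0 expR0 !mulr1.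
have w'0 : w' 0 = p - q by rewrite /w' oppr0 expR0 !mulr1.
have rle x : 0 <= x -> w' x <= (p - q + x) * w x.
  move=> x0; rewrite -ler_pdivrMr //; have [c c0] := is_derive_MVT x0 dr.
  rewrite /r w0 w'0 divr1 => /eqP; rewrite subr_eq => /eqP->.
  rewrite addrC lerD2l ler_piMl // gerBl; exact: sqr_ge0.
pose u (x : R) := - ((p - q) * x + x ^+ 2 / 2).
have du x : is_derive x 1 u (- (p - q + x)).
  have := is_deriveN (is_deriveD (is_deriveZ (p - q) (is_derive_id x (1 : R)))
    (is_deriveZ 2^-1 (is_deriveM (is_derive_id x (1 : R)) (is_derive_id x 1)))).
  congr is_derive; last by rewrite /GRing.scale /=; field.
  apply/funext => y; transitivity (- ((p - q) * y + 2^-1 * (y * y))) => //.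
  by rewrite /u; field.
(* The claim is [G s <= G 0 = 1]; by [rle] the derivative of [G] is nonpositive on the nonnegative
   axis. *)
pose G x := w x * expR (u x).
have dG x : is_derive x 1 G ((w' x - (p - q + x) * w x) * expR (u x)).
  have := is_deriveM (dw x)
    (@is_derive1_comp R expR u x _ _ (is_derive_expR (u x)) (du x)).
  congr is_derive; rewrite /GRing.scale /=; ring.
have [c c0] := is_derive_MVT s0 dG.
have Gle : (w' c - (p - q + c) * w c) * expR (u c) * s <= 0.
  apply: mulr_le0_ge0 => //; apply: mulr_le0_ge0; last exact: expR_ge0.
  by rewrite subr_le0 rle.
have -> : G 0 = 1.
  by rewrite /G w0 /u mulr0 expr0n /= mul0r addr0 oppr0 expR0 mulr1.
move=> E; move: Gle; rewrite -E subr_le0 /G /u expRN -ler_pdivlMr ?invr_gt0 ?expR_gt0 //.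
by rewrite invrK mul1r.
Qed.

(** Convexity: the tangent at [lam * x] lies below the exponential at both ends, and with these
    weights the linear terms cancel. *)
Lemma expR_le_chord lam c x : 0 < c -> `|x| <= c ->
  expR (lam * x) <= (c + x) / (2 * c) * expR (lam * c) +
                    (c - x) / (2 * c) * expR (- (lam * c)).
Proof.
move=> c0; rewrite ler_norml => /andP[xl xu].
have tangent y : expR (lam * x) * (1 + (y - lam * x)) <= expR y.
  rewrite -{2}(subrK (lam * x) y) expRD mulrC ler_wpM2r ?expR_ge0 //.
  exact: expR_ge1Dx.
have P : 0 <= (c + x) / (2 * c) by rewrite divr_ge0 //; lra.
have Q : 0 <= (c - x) / (2 * c) by rewrite divr_ge0 //; lra.
apply: le_trans (lerD (ler_wpM2l P (tangent _)) (ler_wpM2l Q (tangent _))).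
by rewrite le_eqVlt; apply/orP; left; apply/eqP; field; exact: lt0r_neq0.
Qed.

Section FiniteSample.
Variables (S : finType) (X : S -> R) (c mu : R).
Hypotheses (S_gt0 : (0 < #|S|)%N) (c_gt0 : 0 < c).
Hypotheses (X_le : forall s, `|X s| <= c) (X_mean : \sum_s X s = #|S|%:R * mu).

(** Hoeffding's lemma: summing the chord bounds replaces [X] by a variable with values [c] and [-c]
    and the same mean, to which [two_point_mgf] applies at [lam * c]. *)
Lemma mgf_centered_le lam : 0 <= lam ->
  \sum_s expR (lam * (X s - mu)) <= #|S|%:R * expR (lam ^+ 2 * c ^+ 2 / 2).
Proof.
move=> lam0; have N0 : 0 < #|S|%:R :> R by rewrite ltr0n.
have mu_le : `|mu| <= c.
  rewrite -(ler_pM2l N0) -{1}(gtr0_norm N0) -normrM -X_mean.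
  apply: le_trans (ler_norm_sum _ _ _) _.
  apply: le_trans (ler_sum _ (fun s _ => X_le s)) _.
  by rewrite sumr_const mulr_natl.
have := mu_le; rewrite ler_norml => /andP[mul muu].
under eq_bigr do rewrite mulrBr expRD.
rewrite -mulr_suml expRN ler_pdivrMr ?expR_gt0 // -[leRHS]mulrA -expRD.
apply: le_trans (ler_sum _ (fun s _ => expR_le_chord lam c_gt0 (X_le s))) _.
have sumD : \sum_s (c + X s) = #|S|%:R * (c + mu).
  by rewrite big_split /= X_mean sumr_const mulrDr; congr (_ + _); rewrite mulr_natl.
have sumB : \sum_s (c - X s) = #|S|%:R * (c - mu).
  by rewrite sumrB X_mean sumr_const mulrBr; congr (_ - _); rewrite mulr_natl.
rewrite big_split /= -!mulr_suml sumD sumB -!mulrA -mulrDr ler_pM2l // !mulrA.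
apply: le_trans (two_point_mgf _ _ _ _) _.
- by rewrite divr_ge0 //; lra.
- by rewrite divr_ge0 //; lra.
- by field; exact: lt0r_neq0.
- by rewrite mulr_ge0 // ltW.
by rewrite ler_expR; rewrite le_eqVlt; apply/orP; left; apply/eqP; field; exact: lt0r_neq0.
Qed.

(** Chernoff's method for the counting measure: the indicator is below an exponential, whose sum
    over samples factors by coordinates. *)
Lemma card_upper_deviation n e : 0 <= e ->
  #|[set t : {ffun 'I_n -> S} | n%:R * e < \sum_i (X (t i) - mu)]%SET|%:R <=
  #|S|%:R ^+ n * expR (- (n%:R * e ^+ 2 / (2 * c ^+ 2))).
Proof.
(* This [lam] minimizes the exponent [n (lam^2 c^2 / 2 - lam e)]. *)
move=> e0; set A := finset _; pose lam := e / c ^+ 2.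
have lam0 : 0 <= lam by rewrite divr_ge0 // sqr_ge0.
apply: le_trans (_ : \sum_(t : {ffun 'I_n -> S})
   expR (lam * (\sum_i (X (t i) - mu) - n%:R * e)) <= _).
  rewrite -sum1_card natr_sum big_mkcond /=; apply: ler_sum => t _.
  case: ifP => [|_]; last exact: expR_ge0.
  rewrite inE => lt; rewrite -[leLHS]expR0 ler_expR mulr_ge0 // subr_ge0.
  exact: ltW.
under eq_bigr do rewrite mulrBr expRD mulr_sumr expR_sum.
rewrite -mulr_suml -(bigA_distr_bigA (fun _ s => expR (lam * (X s - mu)))) /=.
rewrite prodr_const card_ord.
apply: le_trans (_ : (#|S|%:R * expR (lam ^+ 2 * c ^+ 2 / 2)) ^+ n *
    expR (- (lam * (n%:R * e))) <= _).
  rewrite ler_wpM2r ?expR_ge0 // lerXn2r ?nnegrE ?mgf_centered_le //.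
    by apply: sumr_ge0 => s _; apply: expR_ge0.
rewrite exprMn -expRM_natl -[leLHS]mulrA -expRD ler_wpM2l ?exprn_ge0 // ler_expR.
by rewrite le_eqVlt; apply/orP; left; apply/eqP; rewrite /lam; field; exact: lt0r_neq0.
Qed.

End FiniteSample.

Lemma card_deviation (S : finType) (X : S -> R) c mu n e :
  (0 < #|S|)%N -> 0 < c -> (forall s, `|X s| <= c) ->
  \sum_s X s = #|S|%:R * mu -> 0 <= e ->
  #|[set t : {ffun 'I_n -> S} | n%:R * e < `|\sum_i (X (t i) - mu)| ]%SET|%:R <=
  2 * (#|S|%:R ^+ n * expR (- (n%:R * e ^+ 2 / (2 * c ^+ 2)))).
Proof.
move=> S0 c0 Xc Xmu e0; rewrite [leRHS]mulr_natl mulr2n.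
have Xc' s : `|- X s| <= c by rewrite normrN.
have Xmu' : \sum_s - X s = #|S|%:R * - mu by rewrite sumrN Xmu mulrN.
have h1 := card_upper_deviation S0 c0 Xc Xmu n e0.
have h2 := card_upper_deviation S0 c0 Xc' Xmu' n e0.
apply: le_trans (lerD h1 h2).
rewrite -natrD ler_nat; apply: leq_trans (leq_card_setU _ _).
apply: subset_leq_card; apply/fintype.subsetP => t; rewrite !inE.
rewrite lter_normr -sumrN => /orP[->//|lt]; apply/orP; right.
rewrite (eq_bigr (fun i => - (X (t i) - mu))) // => i _.
by rewrite opprK opprB addrC.
Qed.

End Hoeffding.

(** * Range and mean of the one-tree estimate *)

Section TreeEstimator.
Variables (R : realType) (V : finType) (adj : rel V).
Hypotheses (adj_sym : symmetric adj) (adj_irr : irreflexive adj).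
Hypothesis adj_conn : forall x y : V, connect adj x y.
Hypothesis V_gt1 : (1 < #|V|)%N.
Variables (v : V) (B : stree adj).
Hypothesis B_bfs : bfs_tree adj v (val B).
Implicit Type T : stree adj.

Lemma degree_gt0 u : (0 < degree adj u)%N.
Proof.
have /card_gt1P[x [y [_ _ xNy]]] := V_gt1.
have [w wNu] : exists w, w != u.
  by case: (eqVneq x u) => [xu|]; [exists y; rewrite -xu eq_sym|exists x].
have /connectP[[|z p] /=] := adj_conn u w; first by move=> _ wu; rewrite wu eqxx in wNu.
by move=> /andP[uz _] _; apply/card_gt0P; exists z; rewrite inE.
Qed.

Definition tree_estimate (T : stree adj) : R :=
  \sum_u (degree adj u)%:R * \sum_(ab <- tpath_edges v B u)
    (sigma R v T u ab.1 ab.2 - gflow R v T ab.1 ab.2).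

Lemma kemeny_estE n (T : 'I_n -> stree adj) :
  kemeny_est R v B T = n%:R^-1 * \sum_i tree_estimate (T i).
Proof. by []. Qed.

Lemma natr_sum_degree :
  2 * #|edges adj|%:R = \sum_w (degree adj w)%:R :> R.
Proof. by rewrite -natr_sum sum_degree // natrM. Qed.

Lemma edges_gt0 : (0 < #|edges adj|)%N.
Proof.
have /card_gt0P[w] := degree_gt0 v; rewrite inE => vw.
by apply/card_gt0P; exists [set v; w]; rewrite mem_edges.
Qed.

Lemma diameter_gt0 : (0 < diameter adj)%N.
Proof.
have /card_gt0P[w] := degree_gt0 v; rewrite inE => vw.
apply: leq_trans (dist_diameter adj w v).
apply: leq_trans (size_tpath_bfs adj_sym adj_irr adj_conn w B_bfs).
have [_ + _] := tpathP adj_sym adj_irr v B w.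
by case: tpath => //= wv; rewrite wv adj_irr in vw.
Qed.

(** Both terms take their sign from the orientation of the tree edge and have size in [[0, 1]], as
    [gflow] is a fraction of the total degree [2m]; so the bound is 1, not 2. *)
Lemma sigma_gflow_le T u a b : `|sigma R v T u a b - gflow R v T a b| <= 1.
Proof.
have m0 : 0 < 2 * #|edges adj|%:R :> R by rewrite mulr_gt0 // ltr0n edges_gt0.
pose c : R := (2 * #|edges adj|%:R)^-1.
have g01 a' : 0 <= c * \sum_(w in sub v T a') (degree adj w)%:R <= 1.
  apply/andP; split; first by rewrite mulr_ge0 ?sumr_ge0 // invr_ge0 ltW.
  rewrite /c ler_pdivrMl // mulr1.
  rewrite natr_sum_degree big_mkcond /=; apply: ler_sum => w _; case: ifP => // _.
have /andP[a0 a1] := g01 a; have /andP[b0 b1] := g01 b.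
rewrite /sigma /gflow /= -/c ler_norml.
have [pa|pa] := eqVneq (par v T a) (Some b).
  rewrite (negbTE (par_asym adj_sym adj_irr pa)) /=.
  by case: ifP => _; apply/andP; split; lra.
have [pb|pb] := eqVneq (par v T b) (Some a); rewrite /=; last first.
  by apply/andP; split; lra.
by case: ifP => _; apply/andP; split; lra.
Qed.

Lemma tree_estimate_le T :
  `|tree_estimate T| <= 2 * #|edges adj|%:R * (diameter adj)%:R.
Proof.
rewrite natr_sum_degree mulr_suml; apply: le_trans (ler_norm_sum _ _ _) _.
apply: ler_sum => u _; rewrite normrM normr_nat ler_wpM2l //.
apply: le_trans (ler_norm_sum _ _ _) _.
apply: le_trans (ler_sum _ (fun ab _ => sigma_gflow_le T u ab.1 ab.2)) _.
rewrite big_const_seq count_predT iter_addr_0 size_zip /=.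
rewrite (minn_idPr _) // ler_nat.
apply: leq_trans (dist_diameter adj u v).
exact: size_tpath_bfs.
Qed.

Lemma sum_tree_estimate :
  \sum_(T : stree adj) tree_estimate T = #|{: stree adj}|%:R * kemeny R adj.
Proof.
have N0 : #|{: stree adj}|%:R != 0 :> R.
  by rewrite pnatr_eq0 -lt0n; apply/card_gt0P; exists B.
set N := #|{: stree adj}|%:R in N0 *.
pose phi (a u : V) : R := (forest_potential adj v u a)%:R.
(* Dividing by the number of trees gives the generalized inverse required by [kemenyE]. *)
have LM a w : \sum_(b | adj a b) (phi a w / N - phi b w / N) =
    (a == w)%:R - (a == v)%:R.
  under eq_bigr do rewrite -mulrBl.
  rewrite -mulr_suml forest_potential_laplacian //.
  by rewrite -/N mulrAC divff // mul1r.
rewrite (kemenyE adj_sym adj_irr degree_gt0 LM) exchange_big /= mulr_sumr.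
pose c : R := (2 * #|edges adj|%:R)^-1; rewrite -/c; apply: eq_bigr => u _.
rewrite -mulr_sumr mulrCA; congr (_ * _); rewrite exchange_big /=.
(* Differences of [h] along edges are the sums over trees of [sigma - gflow]; they telescope along
   the BFS path, and [h] vanishes at the root. *)
pose h x := phi x u - c * \sum_w (degree adj w)%:R * phi x w.
transitivity (h u - h v).
  rewrite -(sum_tpath_edges adj_sym adj_irr v B u h).
  rewrite !big_seq; apply: eq_bigr => -[a b] /= ab.
  have {}ab : adj a b.
    move: ab; rewrite mem_tpath_edges_cut // => /and3P[abB _ _].
    have [sB _ _] := stree_spanning adj_sym adj_irr B.
    by rewrite -mem_edges //; apply: (fintype.subsetP sB).
  have gE : \sum_(T : stree adj) gflow R v T a b =
      c * (\sum_w (degree adj w)%:R * phi a w - \sum_w (degree adj w)%:R * phi b w).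
    under eq_bigr do rewrite gflowE //.
    rewrite -mulr_sumr exchange_big -sumrB /=; congr (_ * _).
    by apply: eq_bigr => w _; rewrite -mulr_sumr sum_stree_sigma // mulrBr.
  by rewrite sumrB sum_stree_sigma // gE /h /phi; ring.
have phiv w : phi v w = 0 by rewrite /phi forest_potential_root.
have hv : h v = 0.
  by rewrite /h phiv big1 ?mulr0 ?subrr // => w _; rewrite phiv mulr0.
have mulNK x : N * (x / N) = x by rewrite mulrC mulfVK.
rewrite hv subr0 /h mulrBr mulNK; congr (_ - _).
rewrite [RHS]mulrCA; congr (_ * _); rewrite mulr_sumr.
by apply: eq_bigr => w _; rewrite mulrCA mulNK.
Qed.

End TreeEstimator.

(** * From counting samples to probabilities *)

(** The event is a finite disjoint union of fibers, and by independence each has probability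
    [#|S|^-n]. *)
Lemma uniform_sample_prob (R : realType) (d : measure_display)
    (Omega : measurableType d) (P : probability Omega R) (S : finType) n
    (T : 'I_n -> Omega -> S) (A : {set {ffun 'I_n -> S}}) :
  (forall i, uniform_element P (T i)) -> mutually_independent P T ->
  P [set x | finfun (T ^~ x) \in A]%classic = (#|A|%:R / #|S|%:R ^+ n)%:E.
Proof.
move=> unifT indepT.
pose fiber (t : {ffun 'I_n -> S}) : set Omega :=
  (\bigcap_(i in [set` [set: 'I_n]%SET])
     (T i @^-1` [set` finset.set1 (t i)]))%classic.
have fiberP t x : fiber t x <-> finfun (T ^~ x) = t.
  split=> [tx|<- i _ /=]; last by rewrite ffunE inE.
  by apply/ffunP => i; rewrite ffunE; have := tx i; rewrite /= !inE => /(_ isT)/eqP.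
have set1E (s : S) : ([set` finset.set1 s] = [set s])%classic.
  by apply/seteqP; split=> y /=; rewrite inE => /eqP.
have mfiber t : measurable (fiber t).
  apply: fin_bigcap_measurable => // i _; rewrite set1E.
  by have [] := unifT i (t i).
have Pfiber t : P (fiber t) = (#|S|%:R ^- n)%:E.
  rewrite /fiber indepT.
  under eq_bigr => i _.
    rewrite set1E; have [_ ->] := unifT i (t i); over.
  rewrite prodEFin prodr_const cardsT card_ord exprVn //.
have -> : [set x | finfun (T ^~ x) \in A]%classic =
    (\bigcup_(t in [set` enum A]) fiber t)%classic.
  apply/seteqP; split=> [x /= xA|x [t /= tA /fiberP E]].
    by exists (finfun (T ^~ x)); rewrite /= ?mem_enum //; apply/fiberP.
  by rewrite /= E -mem_enum.
rewrite measure_fin_bigcup //; last first.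
  move=> t1 t2 _ _ [x [/fiberP <- /fiberP <-]] //.
rewrite -fsbig_seq ?enum_uniq //.
transitivity (\sum_(t <- enum A) (#|S|%:R ^- n)%:E : \bar R)%E.
  by apply: eq_bigr => t _; apply: Pfiber.
by rewrite sumEFin big_enum sumr_const [in RHS]mulr_natl.
Qed.

Theorem theorem5p3 (R : realType) (V : finType) (adj : rel V)
  (adj_sym : symmetric adj) (adj_irr : irreflexive adj)
  (adj_conn : forall x y : V, connect adj x y)
  (V_gt1 : (1 < #|V|)%N)
  (v : V) (B : stree adj) (B_bfs : bfs_tree adj v (val B))
  (eps p_f : R) (eps_gt0 : 0 < eps) (p_f_gt0 : 0 < p_f) (p_f_lt1 : p_f < 1)
  (omega : nat)
  (omega_ge : 8 * #|edges adj|%:R ^+ 2 * (diameter adj)%:R ^+ 2 * ln (2 / p_f)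
                / eps ^+ 2 <= omega%:R)
  (d : measure_display) (Omega : measurableType d) (P : probability Omega R)
  (T : 'I_omega -> Omega -> stree adj)
  (T_unif : forall i : 'I_omega, uniform_element P (T i))
  (T_indep : mutually_independent P T) :
  ((1 - p_f)%:E <=
   P [set x | (`|kemeny_est R v B (fun i => T i x) - kemeny R adj| <= eps)%R]%classic)%E.
Proof.
have m_gt0 : 0 < #|edges adj|%:R :> R by rewrite ltr0n (edges_gt0 adj_sym).
have D_gt0 : 0 < (diameter adj)%:R :> R.
  by rewrite ltr0n (diameter_gt0 adj_sym adj_irr adj_conn V_gt1 B_bfs).
pose c : R := 2 * #|edges adj|%:R * (diameter adj)%:R.
have c_gt0 : 0 < c by rewrite !mulr_gt0.
have ln_gt0 : 0 < ln (2 / p_f).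
  by rewrite ln_gt0 // ltr_pdivlMr // mul1r; lra.
(* The lower bound on [omega] is positive, so dividing by [omega] is legitimate. *)
have om_gt0 : 0 < omega%:R :> R.
  by apply: lt_le_trans omega_ge; rewrite divr_gt0 ?exprn_gt0 ?mulr_gt0 ?exprn_gt0.
have S_gt0 : (0 < #|{: stree adj}|)%N by apply/card_gt0P; exists B.
pose X := tree_estimate R v B.
pose bad := [set t : {ffun 'I_omega -> stree adj} |
  omega%:R * eps < `|\sum_i (X (t i) - kemeny R adj)| ]%SET.
have -> : [set x | `|kemeny_est R v B (fun i => T i x) - kemeny R adj| <= eps]%classic
    = [set x | finfun (T ^~ x) \in ~: bad]%classic.
  apply: eq_set => x; rewrite !inE -leNgt kemeny_estE.
  have sumE : \sum_i (X (finfun (T ^~ x) i) - kemeny R adj) =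
      \sum_i X (T i x) - omega%:R * kemeny R adj.
    under eq_bigr do rewrite ffunE.
    by rewrite sumrB sumr_const card_ord mulr_natl.
  have -> : omega%:R^-1 * \sum_i X (T i x) - kemeny R adj =
      omega%:R^-1 * (\sum_i X (T i x) - omega%:R * kemeny R adj).
    by rewrite mulrBr mulKf ?lt0r_neq0.
  by rewrite sumE normrM gtr0_norm ?invr_gt0 // ler_pdivrMl.
rewrite uniform_sample_prob // lee_fin.
have Xle t : `|X t| <= c by apply: tree_estimate_le.
have := card_deviation omega S_gt0 c_gt0 Xle
  (sum_tree_estimate _ adj_sym adj_irr adj_conn V_gt1 v B) (ltW eps_gt0).
rewrite -/bad => bad_le.
have SN0 : 0 < #|{: stree adj}|%:R ^+ omega :> R by rewrite exprn_gt0 // ltr0n.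
have cardC : #|~: bad|%:R = #|{: stree adj}|%:R ^+ omega - #|bad|%:R :> R.
  rewrite -natrX; have <- : (#|bad| + #|~: bad| = #|{: stree adj}| ^ omega)%N.
    by rewrite cardsC card_ffun card_ord.
  by rewrite natrD addrAC subrr add0r.
rewrite cardC ler_pdivlMr // lerBrDr.
(* Since [2 c^2 = 8 m^2 diam^2], the hypothesis on [omega] says exactly that the exponent is at most
   [- ln (2 / p_f)]. *)
have tail : 2 * expR (- (omega%:R * eps ^+ 2 / (2 * c ^+ 2))) <= p_f.
  rewrite -ler_pdivlMl // [leRHS]mulrC -[leRHS]lnK ?posrE ?divr_gt0 // ler_expR.
  rewrite -[p_f / 2]invrK lnV ?posrE ?invr_gt0 ?divr_gt0 // invf_div lerN2.
  rewrite ler_pdivlMr ?mulr_gt0 ?exprn_gt0 //.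
  move: omega_ge; rewrite ler_pdivrMr ?exprn_gt0 //; apply: le_trans.
  by rewrite /c le_eqVlt; apply/orP; left; apply/eqP; ring.
apply: le_trans (lerD (lexx _) bad_le) _.
rewrite mulrCA -[leRHS]mulr1 mulrC -mulrDr ler_pM2l //.
lra.
Qed.
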